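(* Let $k \geq 2$ and let $(\Gamma, v, w)$ be a twice-marked graph of genus $g$ with $k$-general transmission. Then $kv \sim kw$, $r(kv) \geq 1$, and $(\Gamma, v, w)$ is Hurwitz--Brill--Noether general in the following sense: for every divisor $D$ on $\Gamma$ there is a nondecreasing $k$-tuple of integers $\boldsymbol{\mu} = (\mu_1, \ldots, \mu_k)$ with $|\boldsymbol{\mu}| \leq g$ such that the class $[D]$ belongs to the splitting type locus $W^{\boldsymbol{\mu}}(\Gamma)$ with respect to $F = kv$.
   Context: Graphs. The word ''graph'' means either a connected metric graph, or a finite connected graph (parallel edges allowed) with no loop edges; ''points'' are all points of a metric graph, respectively the vertices of a finite graph. A divisor is a $\mathbb{Z}$-linear combination of points; it is effective if all coefficients are nonnegative. Linear equivalence $\sim$ is the usual one (chip-firing for finite graphs; differing by the divisor of a continuous piecewise-linear function with integer slopes for metric graphs). $\operatorname{Pic}^d(\Gamma)$ is the set of linear equivalence classes of degree-$d$ divisors. $r(D)$ is the Baker--Norine rank: $r(D) = -1$ if $D$ is not equivalent to an effective divisor, and otherwise $r(D)$ is the largest $r \ge 0$ such that $D - E$ is equivalent to an effective divisor for every effective $E$ of degree $r$. The genus $g$ is the first Betti number, and $K_\Gamma=\sum_p (\mathrm{val}(p)-2)p$ is the canonical divisor. A twice-marked graph $(\Gamma, v, w)$ is a graph with two chosen points. Submodularity. For a divisor $D$ on $(\Gamma, v, w)$ put $\Delta(D) = r(D) - r(D-v) - r(D-w) + r(D-v-w)$. $D$ is submodular (with respect to $v,w$) if $\Delta(D + av - bw)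 \geq 0$ for all $a,b \in \mathbb{Z}$. Transmission permutation. The transmission permutation of $D$ on $(\Gamma, v, w)$, if it exists, is the unique permutation $\tau^{v,w}_D : \mathbb{Z} \to \mathbb{Z}$ such that the following two (equivalent) equations hold for all $a, b \in \mathbb{Z}$: $r(D + av - bw) + 1 = \#\{ n \geq b : \tau^{v,w}_D(n) \leq a\}$ and $r(K_\Gamma - D - av + bw) + 1 = \#\{ n < b : \tau^{v,w}_D(n) > a \}$. It exists exactly when $D$ is submodular. $k$-general transmission ($k \geq 2$). $\widetilde{\Sigma}_k$ is the group of permutations $\alpha$ of $\mathbb{Z}$ with $\alpha(n+k) = \alpha(n)+k$ for all $n$. An inversion of $\alpha$ is a pair $(x,y)\in\mathbb{Z}^2$ with $x<y$ and $\alpha(x) > \alpha(y)$. For $\alpha \in \widetilde{\Sigma}_k$, two inversions $(x,y), (x',y')$ are $k$-equivalent if $(x',y') = (x+nk, y+nk)$ for some $n \in \mathbb{Z}$; $\operatorname{inv}_k(\alpha)$ is the number of $k$-equivalence classes of inversions of $\alpha$. A genus-$g$ twice-marked graph $(\Gamma, v, w)$ has $k$-general transmission if every divisor $D$ on $\Gamma$ is submodular and satisfies $\tau^{v,w}_D \in \widetilde{\Sigma}_k$ and $\operatorname{inv}_k(\tau^{v,w}_D) \leq g$. Splitting type loci. For a nondecreasing $k$-tuple of integers $\boldsymbol{\mu} = (\mu_1, \ldots, \mu_k)$ define $x_m(\boldsymbol{\mu}) = \sum_{i=1}^k \max\{0, \mu_i + m + 1\}$ for $m \in \mathbb{Z}$,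 $d(\boldsymbol{\mu}) = g - 1 + \sum_{i=1}^k (\mu_i + 1)$, and $|\boldsymbol{\mu}| = \sum_{i<j} \max\{0, \mu_j - \mu_i - 1\}$. For a degree-$k$ divisor $F$ with $r(F) \geq 1$, the splitting type locus with respect to $F$ is $$W^{\boldsymbol{\mu}}(\Gamma) = \{ [D] \in \operatorname{Pic}^{d(\boldsymbol{\mu})}(\Gamma) : r(D + mF) = x_m(\boldsymbol{\mu}) - 1 \text{ for all } m \in \mathbb{Z}\}.$$ *)

(* Defs.v *)
From HB Require Import structures.
From mathcomp Require Import all_boot all_order all_algebra.
From mathcomp Require Import boolp classical_sets functions cardinality reals.
From mathcomp Require Import freeg.

Set Implicit Arguments.
Unset Strict Implicit.
Unset Printing Implicit Defensive.

Import Order.TTheory GRing.Theory Num.Theory.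

Local Open Scope classical_set_scope.
Local Open Scope card_scope.
Local Open Scope ring_scope.

(* The orientation [src], [tgt] of the edges is an arbitrary auxiliary choice;
   loops and parallel edges are allowed here. *)
Record multigraph := Multigraph {
  vertex : finType;
  edge : finType;
  src : edge -> vertex;
  tgt : edge -> vertex
}.

Definition adjacent (G : multigraph) : rel (vertex G) :=
  [rel x y | [exists e : edge G, ((src e == x) && (tgt e == y))
                              || ((src e == y) && (tgt e == x))]].

Definition connected_graph (G : multigraph) : Prop :=
  (exists x : vertex G, True) /\
  forall x y : vertex G, connect (@adjacent G) x y.

(* A loop contributes 2. *)
Definition valence (G : multigraph) (x : vertex G) : nat :=
  (#|[set e : edge G | src e == x]%SET| + #|[set e : edge G | tgt e == x]%SET|)%N.

(* The first Betti number |E| - |V| + 1 of a connected graph; the subtraction is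
   never truncated, since a connected graph has at least |V| - 1 edges. *)
Definition betti1 (G : multigraph) : nat := (#|edge G| + 1 - #|vertex G|)%N.

Record finite_graph := FiniteGraph {
  fin_multigraph :> multigraph;
  fin_connected : connected_graph fin_multigraph;
  fin_loopless : forall e : edge fin_multigraph, src e != tgt e
}.

Definition fire (G : finite_graph) (x : vertex G) : {freeg (vertex G) / int} :=
  \sum_(e : edge G | src e == x) (<<tgt e>> - <<x>>)
  + \sum_(e : edge G | tgt e == x) (<<src e>> - <<x>>).

Definition fin_equiv (G : finite_graph) (D D' : {freeg (vertex G) / int}) : Prop :=
  exists f : vertex G -> int, D' = D + \sum_(x : vertex G) f x *: fire x.

(* A metric graph is presented by a connected multigraph (loops allowed) with
   positive real edge lengths: each edge [e] is an interval [0, len e], with 0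
   glued to [src e] and [len e] glued to [tgt e]. *)
Record metric_graph (R : realType) := MetricGraph {
  met_multigraph :> multigraph;
  met_connected : connected_graph met_multigraph;
  len : edge met_multigraph -> R;
  len_gt0 : forall e, 0 < len e
}.

Section MetricGraph.
Variables (R : realType) (G : metric_graph R).

Definition edge_interior : pred (edge G * R) :=
  [pred q | 0 < q.2 < len q.1].

Definition met_point : Type := (vertex G + {q : edge G * R | edge_interior q})%type.
HB.instance Definition _ := Choice.on met_point.

(* The parametrization [0, len e] -> G of the closed edge [e]. *)
Definition edge_pt (e : edge G) (t : R) : met_point :=
  match insub (e, t) : option {q : edge G * R | edge_interior q} with
  | Some q => inr q
  | None => inl (if t <= 0 then src e else tgt e)
  end.

(* [pl_from g a s]: [a :: s] is strictly increasing and [g] is affine with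
   integer slope on each closed interval between consecutive terms. *)
Fixpoint pl_from (g : R -> R) (a : R) (s : seq R) : Prop :=
  if s is b :: s' then
    [/\ a < b,
        exists m : int, forall t, a <= t <= b -> g t = g a + m%:~R * (t - a)
      & pl_from g b s']
  else True.

(* Piecewise linearity is imposed on the closed edges, with affine pieces that
   agree at the breakpoints, so it includes continuity. *)
Definition pl_function (f : met_point -> R) : Prop :=
  forall e : edge G, exists s : seq R,
    last 0 s = len e /\ pl_from (fun t => f (edge_pt e t)) 0 s.

(* The slope of [g] to the right of 0; for a piecewise linear function with
   integer slopes it exists and is unique. *)
Definition right_slope (g : R -> R) : int :=
  xget 0 [set m : int | exists2 eps : R, 0 < eps &
    forall h, 0 <= h < eps -> g h = g 0 + m%:~R * h].

(* The sum of the outgoing slopes of [f] at a point. *)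
Definition ord_at (f : met_point -> R) (p : met_point) : int :=
  match p with
  | inl x =>
      \sum_(e : edge G | src e == x) right_slope (fun h => f (edge_pt e h))
      + \sum_(e : edge G | tgt e == x)
          right_slope (fun h => f (edge_pt e (len e - h)))
  | inr q =>
      let: (e, t) := val q in
      right_slope (fun h => f (edge_pt e (t + h)))
      + right_slope (fun h => f (edge_pt e (t - h)))
  end.

Definition met_equiv (D D' : {freeg met_point / int}) : Prop :=
  exists2 f : met_point -> R,
    pl_function f & forall p, coeff p (D - D') = ord_at f p.

End MetricGraph.

Variant graph (R : realType) :=
  | Finite of finite_graph
  | Metric of metric_graph R.

Definition graph_point (R : realType) (Gamma : graph R) : choiceType :=
  match Gamma with Finite G => vertex G | Metric G => met_point G end.

Notation divisor Gamma := {freeg (graph_point Gamma) / int}.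

Definition pt (R : realType) (Gamma : graph R) (p : graph_point Gamma) :
  divisor Gamma := <<p>>.

Definition lin_equiv (R : realType) (Gamma : graph R) :
    divisor Gamma -> divisor Gamma -> Prop :=
  match Gamma as Gm return divisor Gm -> divisor Gm -> Prop with
  | Finite G => @fin_equiv G
  | Metric G => @met_equiv R G
  end.

Definition underlying (R : realType) (Gamma : graph R) : multigraph :=
  match Gamma with Finite G => G | Metric G => G end.

Definition vertex_pt (R : realType) (Gamma : graph R) :
    vertex (underlying Gamma) -> graph_point Gamma :=
  match Gamma as Gm return vertex (underlying Gm) -> graph_point Gm with
  | Finite G => fun x => x
  | Metric G => fun x => inl x
  end.

Section Graph.
Variables (R : realType) (Gamma : graph R).
Local Notation divisor := (divisor Gamma).

Definition genus : nat := betti1 (underlying Gamma).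

(* Interior points of edges of a metric graph have valence 2, so only vertices
   contribute. *)
Definition canonical_div : divisor :=
  \sum_(x : vertex (underlying Gamma)) ((valence x)%:Z - 2) *: pt (vertex_pt x).

Definition effective (D : divisor) : Prop :=
  forall p : graph_point Gamma, 0 <= coeff p D.

Definition equiv_effective (D : divisor) : Prop :=
  exists2 D', effective D' & lin_equiv D D'.

Definition rank_ge (D : divisor) (r : nat) : Prop :=
  forall E : divisor, effective E -> deg E = r%:Z -> equiv_effective (D - E).

Definition rank (D : divisor) : int :=
  if `[< equiv_effective D >] then
    (xget 0%N [set r | rank_ge D r /\ forall s, rank_ge D s -> (s <= r)%N])%:Z
  else -1.

Definition div_class (D : divisor) : set divisor := [set D' | lin_equiv D D'].

Definition Pic (d : int) : set (set divisor) :=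
  [set div_class D | D in [set D | deg D = d]].

Variables (v w : graph_point Gamma).

Definition twist (D : divisor) (a b : int) : divisor := D + a *: pt v - b *: pt w.

Definition Delta (D : divisor) : int :=
  rank D - rank (D - pt v) - rank (D - pt w) + rank (D - pt v - pt w).

Definition submodular (D : divisor) : Prop :=
  forall a b : int, 0 <= Delta (twist D a b).

(* [has_card A z]: [A] is finite and its number of elements is the integer [z]. *)
Definition has_card (T : Type) (A : set T) (z : int) : Prop :=
  exists2 n : nat, z = n%:Z & A #= `I_n.

Definition is_transmission (D : divisor) (tau : int -> int) : Prop :=
  [/\ bijective tau,
      forall a b : int,
        has_card [set n | b <= n /\ tau n <= a] (rank (twist D a b) + 1)
    & forall a b : int,
        has_card [set n | n < b /\ a < tau n]
                 (rank (canonical_div - D - a *: pt v + b *: pt w) + 1)].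

Definition affine_perm (k : nat) (alpha : int -> int) : Prop :=
  bijective alpha /\ forall n : int, alpha (n + k%:Z) = alpha n + k%:Z.

Definition inversions (alpha : int -> int) : set (int * int) :=
  [set p | p.1 < p.2 /\ alpha p.2 < alpha p.1].

Definition k_equiv (k : nat) (p q : int * int) : Prop :=
  exists n : int, q = (p.1 + n * k%:Z, p.2 + n * k%:Z).

Definition inversion_classes (k : nat) (alpha : int -> int) :
    set (set (int * int)) :=
  [set [set q | inversions alpha q /\ k_equiv k p q] | p in inversions alpha].

(* inv_k(alpha) <= g *)
Definition inv_le (k : nat) (alpha : int -> int) (g : nat) : Prop :=
  inversion_classes k alpha #<= `I_g.

(* A transmission permutation is determined by [D], so quantifying existentially
   over [tau] amounts to naming it. *)
Definition general_transmission (k : nat) : Prop :=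
  forall D : divisor, submodular D /\
    exists tau : int -> int,
      [/\ is_transmission D tau, affine_perm k tau & inv_le k tau genus].

Definition split_x (k : nat) (mu : k.-tuple int) (m : int) : int :=
  \sum_(i < k) Num.max 0 (tnth mu i + m + 1).

Definition split_deg (k : nat) (mu : k.-tuple int) : int :=
  genus%:Z - 1 + \sum_(i < k) (tnth mu i + 1).

Definition split_size (k : nat) (mu : k.-tuple int) : int :=
  \sum_(i < k) \sum_(j < k | (i < j)%N) Num.max 0 (tnth mu j - tnth mu i - 1).

Definition splitting_locus (k : nat) (mu : k.-tuple int) (F : divisor) :
    set (set divisor) :=
  Pic (split_deg mu) `&`
  [set C | exists2 D, C = div_class D &
     forall m : int, rank (D + m *: F) = split_x mu m - 1].

End Graph.

(* Main.v *)
Require Import Defs.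
From mathcomp Require Import all_boot all_order all_algebra.
From mathcomp Require Import boolp classical_sets functions cardinality reals.
From mathcomp Require Import freeg.
From mathcomp Require Import zify ring lra.

(** The transmission permutation tau of a divisor D turns ranks into counts: the
    rank of D + m k v, plus one, is the number of n >= 0 with tau n <= m k.
    Since tau commutes with translation by k, these n can be sorted by their
    residue i modulo k: i + j k counts exactly when j <= nu_i + m, where nu_i is
    the floor of - tau(i) / k ([residue_level]).  The residue i thus contributes
    max(0, nu_i + m + 1), so the sorted tuple of the nu_i is the splitting type
    of D ([card_low_values], [transmission_levels]).

    Size.  For residues i, j and 1 <= l <= nu_j - nu_i - 1, the pair
    (i, j + l k) is an inversion of tau, and different triples (i, j, l) give
    inversions that are not k-equivalent.  Summing over i and j bounds the size
    of the splitting type by the number of inversion classes, hence by the genus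
    ([sum_levels_inversions]).

    Degree.  The splitting locus also prescribes deg D = g - 1 + sum (nu_i + 1),
    which is Riemann-Roch, because chi(D) := r(D) - r(K - D) equals
    sum (nu_i + 1).  Riemann-Roch follows from the existence of transmission
    permutations.  By the two counting formulas chi(D + m k v) = chi(D) + m k,
    and chi(D + m k v) = r(D + m k v) + 1 for large m; as adding an effective E
    raises the rank by at most deg E, the excess deg - chi cannot decrease when
    an effective divisor is added.  It is also invariant under linear
    equivalence and under adding k v.  For any D and D', the divisor
    D' - D + m k v is equivalent to an effective one for large m, so the excess
    of D is at most that of D', and the excess is constant.  Duality
    chi(K - D) = - chi(D) and deg K = 2 g - 2 give the constant g - 1
    ([chi_deg_le], [chi_deg]).

    The relation k v ~ k w.  Periodicity of the transmission permutation of 0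
    gives r(k v - k w) = r(0) = 0, so k v - k w is equivalent to an effective
    divisor of degree 0 ([rank_twist_period]).  The bound r(k v) >= 1 compares
    the counts for m = 0 and m = 1.

    These arguments use that linear equivalence is a congruence preserving
    degrees.  For metric graphs this needs a common refinement of the
    breakpoints of two piecewise linear functions ([pl_fromB]) and the
    cancellation of slopes along each edge ([pl_slope_divisor]). *)

Import Order.TTheory GRing.Theory Num.Theory.

Set Implicit Arguments.
Unset Strict Implicit.
Unset Printing Implicit Defensive.

Local Open Scope classical_set_scope.
Local Open Scope card_scope.
Local Open Scope ring_scope.

(** * Slopes of piecewise linear functions *)

Section Slopes.
Variable R : realType.
Implicit Types (g : R -> R) (a b t : R) (m : int) (s : seq R).

(** A witness for [right_slope], whose value is only meaningful when such a
    slope exists. *)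
Definition has_slope g m := exists2 eps : R, 0 < eps &
  forall h, 0 <= h < eps -> g h = g 0 + m%:~R * h.

Lemma has_slopeE g m : has_slope g m -> right_slope g = m.
Proof.
move=> [e e0 gm]; apply: xget_unique; first by exists e.
move=> n [d d0 gn].
pose h := Num.min e d / 2.
have md0 : 0 < Num.min e d by rewrite lt_min e0 d0.
have h0 : 0 < h by rewrite divr_gt0.
have hlt : h < Num.min e d by rewrite /h; lra.
move: hlt; rewrite lt_min => /andP[he hd].
have := gm h; rewrite he ltW // => /(_ isT).
rewrite gn ?hd ?ltW // => /addrI/mulIf; rewrite gt_eqF // => /(_ isT).
by move/eqP; rewrite eqr_int => /eqP.
Qed.

Lemma has_slopeB g1 g2 m1 m2 : has_slope g1 m1 -> has_slope g2 m2 ->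
  has_slope (fun h => g1 h - g2 h) (m1 - m2).
Proof.
move=> [e e0 gm] [d d0 gn]; exists (Num.min e d); first by rewrite lt_min e0.
move=> h /andP[h0]; rewrite lt_min => /andP[he hd].
by rewrite gm ?h0 ?he // gn ?h0 ?hd // rmorphB /=; ring.
Qed.

Lemma right_slopeB g1 g2 m1 m2 : has_slope g1 m1 -> has_slope g2 m2 ->
  right_slope (fun h => g1 h - g2 h) = right_slope g1 - right_slope g2.
Proof.
by move=> h1 h2; rewrite (has_slopeE (has_slopeB h1 h2)) (has_slopeE h1) (has_slopeE h2).
Qed.

Lemma pl_from_le g a s : pl_from g a s -> a <= last a s.
Proof.
elim: s a => [//|b s IH] a /= [ab _ /IH]; exact/le_trans/ltW.
Qed.

Lemma affine_slope_right g a b m t : a <= t < b ->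
  (forall u, a <= u <= b -> g u = g a + m%:~R * (u - a)) ->
  has_slope (fun h => g (t + h)) m.
Proof.
move=> /andP[at_ tb] gm; exists (b - t); first by rewrite subr_gt0.
by move=> h /andP[h0 hb]; rewrite addr0 (gm (t + h)) ?(gm t); [ring | lra | lra].
Qed.

Lemma affine_slope_left g a b m t : a < t <= b ->
  (forall u, a <= u <= b -> g u = g a + m%:~R * (u - a)) ->
  has_slope (fun h => g (t - h)) (- m).
Proof.
move=> /andP[at_ tb] gm; exists (t - a); first by rewrite subr_gt0.
by move=> h /andP[h0 hb]; rewrite subr0 (gm (t - h)) ?(gm t) ?rmorphN /=; [ring | lra | lra].
Qed.

Lemma pl_slope_right g a s t : pl_from g a s -> a <= t < last a s ->
  exists m, has_slope (fun h => g (t + h)) m.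
Proof.
elim: s a => [|b s IH] a /=; first by move=> _ ?; exfalso; lra.
move=> [ab [m gm] pl] /andP[at_ tl]; have [tb|bt] := ltP t b.
  by exists m; apply: affine_slope_right gm; rewrite at_.
by apply: IH pl _; rewrite bt.
Qed.

Lemma pl_slope_left g a s t : pl_from g a s -> a < t <= last a s ->
  exists m, has_slope (fun h => g (t - h)) m.
Proof.
elim: s a => [|b s IH] a /=; first by move=> _ ?; exfalso; lra.
move=> [ab [m gm] pl] /andP[at_ tl]; have [tb|bt] := leP t b.
  by exists (- m); apply: affine_slope_left gm; rewrite at_.
by apply: IH pl _; rewrite bt.
Qed.

Lemma affine_from g a b c m :
    (forall u, a <= u <= c -> g u = g a + m%:~R * (u - a)) -> a <= b <= c ->
  forall u, b <= u <= c -> g u = g b + m%:~R * (u - b).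
Proof. by move=> gm abc u buc; rewrite (gm u) ?(gm b); [ring|lra|lra]. Qed.

(** Merging the two breakpoint lists: the smaller of the two first breakpoints
    splits the affine piece of the other function into two affine pieces. *)
Lemma pl_fromB g1 g2 a s1 s2 : pl_from g1 a s1 -> pl_from g2 a s2 ->
    last a s1 = last a s2 ->
  exists s, last a s = last a s1 /\ pl_from (fun t => g1 t - g2 t) a s.
Proof.
have [n] := ubnP (size s1 + size s2)%N.
elim: n => // n IH in a s1 s2 *.
case: s1 s2 => [|b1 s1] [|b2 s2] /=.
- by exists [::].
- by move=> _ _ [ab _ /pl_from_le bl] E; exfalso; lra.
- by move=> _ [ab _ /pl_from_le bl] _ E; exfalso; lra.
rewrite !ltnS => sz [ab1 [m1 gm1] pl1] [ab2 [m2 gm2] pl2] E.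
have aff b : a < b -> b <= b1 -> b <= b2 -> exists m : int,
    forall t, a <= t <= b -> g1 t - g2 t = g1 a - g2 a + m%:~R * (t - a).
  move=> ab l1 l2; exists (m1 - m2) => t tab.
  by rewrite (gm1 t) ?(gm2 t) ?rmorphB /=; [ring|lra|lra].
have [lt12|lt21|eq12] := ltgtP b1 b2.
- have [||s [ls pls]] := IH b1 s1 (b2 :: s2) _ pl1 _ E.
  + by move: sz => /=; lia.
  + split=> //; exists m2; apply: affine_from gm2 _; lra.
  by exists (b1 :: s); split => //=; split=> //; apply: aff => //; exact: ltW.
- have [||s [ls pls]] := IH b2 (b1 :: s1) s2 _ _ pl2 E.
  + by move: sz => /=; lia.
  + split=> //; exists m1; apply: affine_from gm1 _; lra.
  by exists (b2 :: s); split => //=; split=> //; apply: aff => //; exact: ltW.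
- rewrite -eq12 in gm2 pl2 E aff.
  have [|s [ls pls]] := IH b1 s1 s2 _ pl1 pl2 E; first by move: sz => /=; lia.
  by exists (b1 :: s); split => //=; split=> //; apply: aff.
Qed.

(** The divisor of a piecewise linear function on a segment.  A piece of slope m
    on an interval from a to b contributes m at a and - m at b, so the degree is
    0 and the two contributions at a breakpoint add up to the sum of the outgoing
    slopes. *)
Lemma pl_slope_divisor g a s : pl_from g a s ->
  exists D : {freeg R / int}, deg D = 0 /\ forall t, coeff t D =
    (if a <= t < last a s then right_slope (fun h => g (t + h)) else 0)
    + (if a < t <= last a s then right_slope (fun h => g (t - h)) else 0).
Proof.
elim: s a => [|b s IH] a /=.
  move=> _; exists 0; split=> [|t]; first exact: deg0.
  rewrite coeff0; case: ifP => [|_]; first by move=> ?; exfalso; lra.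
  by case: ifP => // ?; exfalso; lra.
move=> [ab [m gm] pl]; have [D [D0 cD]] := IH b pl; have bl := pl_from_le pl.
exists (<< m *g a >> - << m *g b >> + D); split=> [|t].
  by rewrite degD degB !degU subrr add0r D0.
rewrite coeffD coeffB !coeffU cD.
have rs u : a <= u < b -> right_slope (fun h => g (u + h)) = m.
  by move=> aub; apply: has_slopeE; apply: affine_slope_right gm.
have ls u : a < u <= b -> right_slope (fun h => g (u - h)) = - m.
  by move=> aub; apply: has_slopeE; apply: affine_slope_left gm.
have al := lt_le_trans ab bl.
have [ta|ta|->{t}] := ltgtP t a.
- have tb := lt_trans ta ab.
  by rewrite (gt_eqF tb) (lt_geF tb) (le_gtF (ltW tb)) /= !mulr0; lia.
- have [tb|tb|->{t ta}] := ltgtP t b.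
  + have tl := lt_le_trans tb bl.
    by rewrite tl (ltW tl) /= rs ?ls ?(ltW ta) ?ta ?tb ?(ltW tb) //=; lia.
  + by rewrite /=; lia.
  + rewrite bl /= ls ?ab ?lexx //.
    by case: ifP => _; lia.
- by rewrite (gt_eqF ab) (lt_geF ab) (lt_gtF ab) al rs ?lexx ?ab //=; lia.
Qed.

End Slopes.

(** * Divisors of rational functions on a metric graph *)

Lemma degZ (K : choiceType) (c : int) (D : {freeg K / int}) :
  deg (c *: D) = c * deg D.
Proof. by rewrite -{1}[c]intz scaler_int raddfMz mulrzz mulrC. Qed.

Lemma coeff_dom_sum (K : choiceType) (D : {freeg K / int}) t :
  coeff t D = \sum_(z <- dom D) coeff z D * (z == t)%:R.
Proof.
rewrite -{1}[D]freeg_sumE raddf_sum.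
by apply: eq_bigr => z _; rewrite /= coeffU.
Qed.

Definition pushforward (K L : choiceType) (f : K -> L) (D : {freeg K / int}) :
    {freeg L / int} :=
  \sum_(z <- dom D) << coeff z D *g f z >>.

Lemma deg_pushforward (K L : choiceType) (f : K -> L) (D : {freeg K / int}) :
  deg (pushforward f D) = deg D.
Proof.
rewrite -{2}[D]freeg_sumE !raddf_sum.
by apply: eq_bigr => z _; rewrite /= !degU.
Qed.

Lemma coeff_pushforward (K L : choiceType) (f : K -> L) (D : {freeg K / int}) p :
  coeff p (pushforward f D) = \sum_(z <- dom D) coeff z D * (f z == p)%:R.
Proof. by rewrite raddf_sum; apply: eq_bigr => z _; rewrite /= coeffU. Qed.

Section MetricPrincipal.
Variables (R : realType) (G : metric_graph R).
Implicit Types (f g : met_point G -> R) (e : edge G) (t : R).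

Lemma edge_pt_src e t : t <= 0 -> edge_pt e t = inl (src e).
Proof.
move=> t0; rewrite /edge_pt insubF ?t0 //.
by rewrite /edge_interior /= ltNge t0.
Qed.

Lemma edge_pt_tgt e t : len e <= t -> edge_pt e t = inl (tgt e).
Proof.
move=> lt; rewrite /edge_pt insubF.
  by rewrite leNgt (lt_le_trans (len_gt0 e) lt).
by rewrite /edge_interior /= [t < _]ltNge lt andbF.
Qed.

Lemma edge_pt_interior e t (h : edge_interior (e, t)) :
  edge_pt e t = inr (exist _ (e, t) h).
Proof. by rewrite /edge_pt insubT. Qed.

Lemma edge_slope_right f e t : pl_function f -> 0 <= t < len e ->
  exists m, has_slope (fun h => f (edge_pt e (t + h))) m.
Proof.
move=> /(_ e)[s [ls pl]] te; apply: (pl_slope_right (g := fun t => f (edge_pt e t)) pl).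
by rewrite ls.
Qed.

Lemma edge_slope_left f e t : pl_function f -> 0 < t <= len e ->
  exists m, has_slope (fun h => f (edge_pt e (t - h))) m.
Proof.
move=> /(_ e)[s [ls pl]] te; apply: (pl_slope_left (g := fun t => f (edge_pt e t)) pl).
by rewrite ls.
Qed.

Lemma src_slope f e : pl_function f ->
  exists m, has_slope (fun h => f (edge_pt e h)) m.
Proof.
move=> /(edge_slope_right (e := e) (t := 0)); rewrite lexx len_gt0.
move=> /(_ isT)[m]; rewrite (_ : (fun h => _) = fun h => f (edge_pt e h)).
  by exists m.
by apply/funext => h; rewrite add0r.
Qed.

Lemma pl_functionB f g : pl_function f -> pl_function g ->
  pl_function (fun p => f p - g p).
Proof.
move=> pf pg e; have [s [ls pls]] := pf e; have [s' [ls' pls']] := pg e.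
have [|u [lu plu]] := pl_fromB pls pls'; first by rewrite ls ls'.
by exists u; rewrite lu.
Qed.

Lemma ord_atB f g p : pl_function f -> pl_function g ->
  ord_at (fun p => f p - g p) p = ord_at f p - ord_at g p.
Proof.
move=> pf pg; case: p => [x|[[e t] /= te]] /=.
  rewrite opprD addrACA -!sumrB; congr (_ + _); apply: eq_bigr => e _.
    have [m hm] := src_slope e pf; have [n hn] := src_slope e pg.
    exact: right_slopeB hm hn.
  have le : 0 < len e <= len e by rewrite len_gt0 lexx.
  have [m hm] := edge_slope_left pf le; have [n hn] := edge_slope_left pg le.
  exact: right_slopeB hm hn.
case/andP: (te) => t0 tl.
have hr : 0 <= t < len e by rewrite ltW.
have hl : 0 < t <= len e by rewrite t0 ltW.
have [m1 hm1] := edge_slope_left pf hl; have [n1 hn1] := edge_slope_left pg hl.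
have [m2 hm2] := edge_slope_right pf hr; have [n2 hn2] := edge_slope_right pg hr.
by rewrite (right_slopeB hm1 hn1) (right_slopeB hm2 hn2); ring.
Qed.

(** The orders of [f] have finite support and add up to 0: they come from gluing
    the degree-0 divisors of [f] on the closed edges. *)
Lemma ord_at_divisor f : pl_function f ->
  exists D : {freeg (met_point G) / int},
    deg D = 0 /\ forall p, coeff p D = ord_at f p.
Proof.
move=> pf.
have edgeD e : exists D : {freeg R / int}, deg D = 0 /\ forall t, coeff t D =
    (if 0 <= t < len e then right_slope (fun h => f (edge_pt e (t + h))) else 0)
    + (if 0 < t <= len e then right_slope (fun h => f (edge_pt e (t - h))) else 0).
  have [s [ls pl]] := pf e; rewrite -ls; exact: pl_slope_divisor pl.
have /choice[D hD] := edgeD.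
exists (\sum_e pushforward (edge_pt e) (D e)); split=> [|p].
  rewrite raddf_sum big1 // => e _ /=.
  by rewrite deg_pushforward (proj1 (hD e)).
rewrite raddf_sum /=; case: p => [x|[[e t] te]] /=; last first.
  rewrite (bigD1 e) //= big1 => [|e' ne]; rewrite coeff_pushforward.
    (* An interior point of [e] has a single preimage, on [e] only. *)
    have eqE z : (edge_pt e z == inr (exist _ (e, t) te)) = (z == t).
      have [->|nz] := eqVneq z t; first by rewrite (edge_pt_interior te) eqxx.
      have [z0|z0] := leP z 0; first by rewrite edge_pt_src.
      have [z1|z1] := leP (len e) z; first by rewrite edge_pt_tgt.
      have hz : edge_interior (e, z) by rewrite /edge_interior /= z0.
      rewrite (edge_pt_interior hz); apply/eqP => -[E].
      by rewrite E eqxx in nz.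
    under eq_bigr => z _ do rewrite eqE.
    rewrite -coeff_dom_sum (proj2 (hD e)) addr0.
    by case/andP: (te) => /= t0 tl; rewrite t0 tl !ltW.
  rewrite big1 // => z _; rewrite (_ : _ == _ = false) ?mulr0 //.
  have [z0|z0] := leP z 0; first by rewrite edge_pt_src.
  have [z1|z1] := leP (len e') z; first by rewrite edge_pt_tgt.
  have hz : edge_interior (e', z) by rewrite /edge_interior /= z0.
  rewrite (edge_pt_interior hz); apply/eqP => -[E _].
  by rewrite E eqxx in ne.
rewrite [X in _ = X + _]big_mkcond [X in _ = _ + X]big_mkcond /= -big_split /=.
apply: eq_bigr => e _; rewrite coeff_pushforward.
have l0 := len_gt0 e.
(* On the closed edge only the endpoints are mapped to vertices; both may be
   mapped to the same vertex when [e] is a loop. *)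
transitivity (\sum_(z <- dom (D e)) (coeff z (D e) * (z == 0)%:R * (src e == x)%:R
    + coeff z (D e) * (z == len e)%:R * (tgt e == x)%:R)).
  apply: eq_big_seq => z; rewrite mem_dom => cz.
  have /andP[z0 z1] : 0 <= z <= len e.
    move: cz; apply: contraNT; rewrite negb_and -!ltNge (proj2 (hD e)) => /orP[zl|zl].
      by rewrite (lt_geF zl) (lt_gtF zl).
    by rewrite (lt_gtF zl) (lt_geF zl) !andbF.
  rewrite -!mulrA -mulrDr; congr (_ * _).
  move: z0; rewrite le_eqVlt => /predU1P[<-|z0].
    by rewrite edge_pt_src // eqxx (lt_eqF l0) mul1r mul0r addr0.
  move: z1; rewrite le_eqVlt => /predU1P[->|z1].
    by rewrite edge_pt_tgt // eqxx (gt_eqF l0) mul1r mul0r add0r.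
  have hz : edge_interior (e, z) by rewrite /edge_interior /= z0.
  by rewrite (edge_pt_interior hz) (gt_eqF z0) (lt_eqF z1) !mul0r addr0.
rewrite big_split /= -!mulr_suml -!coeff_dom_sum !(proj2 (hD e)).
rewrite lexx ltxx l0 (ltW l0) lexx ltxx /= addr0 add0r !mulr_natr !mulrb.
by congr (_ + _); congr (if _ then right_slope _ else _); apply/funext => h; rewrite add0r.
Qed.

End MetricPrincipal.

(** * Linear equivalence *)

Section LinearEquivalence.
Variables (R : realType) (Gamma : graph R).
Implicit Types D E : divisor Gamma.

Lemma lin_equiv_refl D : lin_equiv D D.
Proof.
case: Gamma D => [G|G] D /=.
  by exists (fun=> 0); rewrite big1 ?addr0 // => x _; rewrite scale0r.
have pl0 : pl_function (fun _ : met_point G => 0 : R).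
  move=> e; exists [:: len e]; split=> //=; split=> //; first exact: len_gt0.
  by exists 0 => t _; rewrite mul0r addr0.
exists (fun p => (fun=> 0) p - (fun=> 0) p); first exact: (pl_functionB pl0 pl0).
by move=> p; rewrite (ord_atB _ pl0 pl0) !subrr coeff0.
Qed.

(** With reflexivity, compatibility with subtraction makes linear equivalence a
    congruence: symmetry and transitivity follow formally. *)
Lemma lin_equivB D1 D1' D2 D2' :
  lin_equiv D1 D1' -> lin_equiv D2 D2' -> lin_equiv (D1 - D2) (D1' - D2').
Proof.
case: Gamma D1 D1' D2 D2' => [G|G] D1 D1' D2 D2' /=.
  move=> [f ->] [g ->]; exists (fun x => f x - g x).
  rewrite opprD addrACA -sumrB; congr (_ + _).
  by apply: eq_bigr => x _; rewrite scalerBl.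
move=> [f pf cf] [g pg cg]; exists (fun p => f p - g p); first exact: pl_functionB.
move=> p; rewrite (ord_atB _ pf pg) -cf -cg !coeffB; ring.
Qed.

Lemma lin_equiv_deg D D' : lin_equiv D D' -> deg D = deg D'.
Proof.
case: Gamma D D' => [G|G] D D' /=.
  move=> [f ->]; rewrite degD raddf_sum big1 ?addr0 // => x _.
  rewrite /= degZ /fire degD !raddf_sum !big1 ?addr0 ?mulr0 //= => e _;
    by rewrite degB !degU subrr.
move=> [f pf cf]; have [D0 [deg0 c0]] := ord_at_divisor pf.
have /eqP E : D - D' == D0 by apply/freeg_eqP => p; rewrite cf c0.
by apply/eqP; rewrite -subr_eq0 -degB E deg0.
Qed.

Lemma lin_equivD2r E D D' : lin_equiv D D' -> lin_equiv (D + E) (D' + E).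
Proof.
by move=> DD'; rewrite -[E]opprK; apply: lin_equivB DD' _; exact: lin_equiv_refl.
Qed.

Lemma lin_equiv_sym D D' : lin_equiv D D' -> lin_equiv D' D.
Proof.
move=> DD'; have := lin_equivB (lin_equiv_refl (D + D')) DD'.
by rewrite addrK addrAC subrr add0r.
Qed.

Lemma lin_equiv_trans D1 D2 D3 :
  lin_equiv D1 D2 -> lin_equiv D2 D3 -> lin_equiv D1 D3.
Proof.
move=> h12 /lin_equiv_sym h32; have := lin_equivD2r D3 (lin_equivB h12 h32).
by rewrite !subrK subrr add0r.
Qed.

End LinearEquivalence.

(** * The degree of the canonical divisor *)

Section CanonicalDegree.

(** This makes the truncated subtraction in [betti1] exact.  A proper nonempty
    vertex set is left by some edge, so a vertex set can grow one vertex at a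
    time, gaining at least one inner edge at each step. *)
Lemma leq_vertex_edge (G : multigraph) :
  connected_graph G -> (#|vertex G| <= #|edge G| + 1)%N.
Proof.
move=> [[x0 _] conn].
pose inner (A : {set vertex G}) : {set edge G} := [set e | (src e \in A) && (tgt e \in A)]%SET.
suff grow n : (n < #|vertex G|)%N ->
    exists A : {set vertex G}, #|A| = n.+1 /\ (n <= #|inner A|)%N.
  have V0 : (0 < #|vertex G|)%N by apply/card_gt0P; exists x0.
  have [|A [_ leA]] := grow #|vertex G|.-1; first by rewrite prednK.
  have leE : (#|inner A| <= #|edge G|)%N by exact: max_card.
  by lia.
elim: n => [_|n IH ltn].
  by exists [set x0]%SET; rewrite cards1.
have [|A [cA leA]] := IH; first exact: ltnW.
have [x [y [xA yA xy]]] : exists x y, [/\ x \in A, y \notin A & adjacent x y].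
  have [y yA] : exists y, y \notin A.
    apply/existsP; rewrite -negb_forall; apply/negP => /forallP all_in.
    have : #|A| = #|vertex G| by apply: eq_card => z; rewrite all_in.
    lia.
  have /card_gt0P[x xA] : (0 < #|A|)%N by rewrite cA.
  have /connectP[p + lastp] := conn x y.
  rewrite {}lastp in yA; elim: p x xA yA => [x xA|z p IHp x xA yA /=].
    by rewrite /= xA.
  move=> /andP[xz pz]; have [zA|zA] := boolP (z \in A); first exact: IHp zA _ pz.
  by exists x, z.
exists (y |: A)%SET; rewrite cardsU1 yA cA; split=> //.
have /existsP[e exy] := xy.
apply: leq_ltn_trans leA _; apply: proper_card; rewrite properE; apply/andP; split.
  by apply/fintype.subsetP => e'; rewrite !inE => /andP[-> ->]; rewrite !orbT.
apply/fintype.subsetPn; exists e.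
  by rewrite !inE; case/orP: exy => /andP[/eqP-> /eqP->]; rewrite xA eqxx ?orbT.
by rewrite !inE; case/orP: exy => /andP[/eqP-> /eqP->]; rewrite (negbTE yA) ?andbF.
Qed.

Variables (R : realType) (Gamma : graph R).

Lemma underlying_connected : connected_graph (underlying Gamma).
Proof. by case: Gamma => G; [exact: fin_connected | exact: met_connected]. Qed.

(** Handshake: each edge is counted once at its source and once at its target. *)
Lemma sum_valence (G : multigraph) : (\sum_(x : vertex G) valence x = 2 * #|edge G|)%N.
Proof.
rewrite big_split /= mul2n -addnn.
rewrite -sum1_card; congr (_ + _)%N.
  rewrite [RHS](partition_big (@src G) xpredT) //=.
  by apply: eq_bigr => x _; rewrite -sum1dep_card.
rewrite [RHS](partition_big (@tgt G) xpredT) //=.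
by apply: eq_bigr => x _; rewrite -sum1dep_card.
Qed.

Lemma deg_canonical : deg (canonical_div Gamma) = 2 * (genus Gamma)%:Z - 2.
Proof.
rewrite raddf_sum /=; under eq_bigr => x _ do rewrite degZ degU mulr1 -[Posz (valence x)]natz.
rewrite sumrB -natr_sum sum_valence natz sumr_const.
rewrite [X in _ - _ *+ X](_ : _ = #|vertex (underlying Gamma)|); last exact: eq_card.
have := leq_vertex_edge underlying_connected; rewrite -mulr_natr natz /genus /betti1.
lia.
Qed.

End CanonicalDegree.

(** * The Baker-Norine rank *)

Section Rank.
Variables (R : realType) (Gamma : graph R).
Implicit Types (D E : divisor Gamma) (v : graph_point Gamma).

Lemma deg_pt v : deg (pt v) = 1.
Proof. exact: degU. Qed.

Lemma effective_multiple v (n : nat) : effective (n%:Z *: pt v).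
Proof. by move=> p; rewrite coeffZ coeffU mul1r; case: eqP => _; rewrite ?mulr0 ?mulr1. Qed.

Lemma effectiveD D E : effective D -> effective E -> effective (D + E).
Proof. by move=> effD effE p; rewrite coeffD addr_ge0. Qed.

Lemma effective_deg_ge0 D : effective D -> 0 <= deg D.
Proof.
move=> effD; rewrite -[D]freeg_sumE raddf_sum sumr_ge0 // => z _.
by rewrite /= degU.
Qed.

Lemma effective_deg0 D : effective D -> deg D = 0 -> D = 0.
Proof. by move=> effD; apply: fgpos_eq0P; apply/fgposP. Qed.

Lemma equiv_effective_congr D D' :
  lin_equiv D D' -> equiv_effective D -> equiv_effective D'.
Proof.
move=> /lin_equiv_sym D'D [E effE DE]; exists E => //.
exact: lin_equiv_trans D'D DE.
Qed.

Lemma equiv_effectiveD D E :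
  equiv_effective D -> effective E -> equiv_effective (D + E).
Proof.
move=> [F effF DF] effE; exists (F + E); first exact: effectiveD.
exact: lin_equivD2r.
Qed.

Lemma rank_ge_deg v D s : rank_ge D s -> s%:Z <= deg D.
Proof.
move=> /(_ (s%:Z *: pt v) (effective_multiple v s)).
rewrite degZ deg_pt mulr1 => /(_ erefl)[F /effective_deg_ge0 F0 /lin_equiv_deg].
by rewrite degB degZ deg_pt mulr1; lia.
Qed.

(** A test divisor of degree s becomes one of degree r by adding a multiple of a
    point. *)
Lemma rank_ge_leq v D r s : (s <= r)%N -> rank_ge D r -> rank_ge D s.
Proof.
move=> sr geD E effE degE; pose F := (r - s)%N%:Z *: pt v.
have effF : effective F by exact: effective_multiple.
have -> : D - E = D - (E + F) + F by rewrite opprD addrA subrK.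
apply: equiv_effectiveD => //; apply: geD; first exact: effectiveD.
by rewrite degD degE degZ deg_pt mulr1 -PoszD subnKC.
Qed.

Lemma rank_ge0 D : rank_ge D 0 <-> equiv_effective D.
Proof.
split=> [/(_ 0)|effD E effE degE].
  by rewrite subr0 deg0; apply=> // p; rewrite coeff0.
by rewrite (effective_deg0 effE degE) subr0.
Qed.

Lemma rank_geN1 D : -1 <= rank D.
Proof. by rewrite /rank; case: asboolP. Qed.

(** The maximum in the definition of the rank exists because the degree of [D]
    bounds all admissible values, and the admissible values are downward closed. *)
Lemma rank_geP v D (s : nat) : s%:Z <= rank D <-> rank_ge D s.
Proof.
rewrite /rank; case: asboolP => [effD|NeffD]; last first.
  by split=> [//|/(rank_ge_leq v (leq0n s))/rank_ge0].
have exmax : exists r, rank_ge D r /\ forall s, rank_ge D s -> (s <= r)%N.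
  have bounded r : rank_ge D r -> (r <= absz (deg D))%N.
    by move=> /(rank_ge_deg v); lia.
  have ex0 : exists r, `[< rank_ge D r >].
    by exists 0; apply/asboolP/rank_ge0.
  have bnd r : `[< rank_ge D r >] -> (r <= absz (deg D))%N by move/asboolP/bounded.
  case: (ex_maxnP ex0 bnd) => r /asboolP gr max_r.
  by exists r; split=> // u /asboolP /max_r.
have [gex maxx] := xgetPex 0%N exmax.
rewrite lez_nat; split=> [le|]; last exact: maxx.
exact: rank_ge_leq le gex.
Qed.

Lemma ler_rank v D D' : (forall s, rank_ge D s -> rank_ge D' s) -> rank D <= rank D'.
Proof.
move=> sub; case E : (rank D) (rank_geN1 D) => [s|[|s]] // _; last exact: rank_geN1.
by apply/(rank_geP v)/sub/(rank_geP v); rewrite E.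
Qed.

Lemma rank_lin_equiv v D D' : lin_equiv D D' -> rank D = rank D'.
Proof.
suff le (A B : divisor Gamma) : lin_equiv A B -> rank A <= rank B.
  by move=> DD'; apply/eqP; rewrite eq_le !le //; apply: lin_equiv_sym.
move=> AB; apply: (ler_rank v) => s geA E effE degE.
apply: equiv_effective_congr (geA E effE degE); exact: lin_equivD2r.
Qed.

(** A test divisor F for D becomes the test divisor F + E for D + E. *)
Lemma rank_addE v D E : effective E -> rank (D + E) <= rank D + deg E.
Proof.
move=> effE; have dE := effective_deg_ge0 effE.
have [lt|ge] := ltP (rank (D + E)) (deg E).
  by have := rank_geN1 D; lia.
case rkE : (rank (D + E)) ge => [n|n] ge; last by lia.
have /(rank_geP v) geD : n%:Z <= rank (D + E) by rewrite rkE.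
rewrite -lerBlDr; case sE : (n%:Z - deg E) => [s|s]; last by lia.
apply/(rank_geP v) => F effF degF.
have -> : D - F = D + E - (F + E) by rewrite opprD addrACA subrr addr0.
by apply: geD; [exact: effectiveD | rewrite degD degF; lia].
Qed.

Lemma rank0 v : rank (0 : divisor Gamma) = 0.
Proof.
have le0 : 0%:Z <= rank (0 : divisor Gamma).
  apply/(rank_geP v)/rank_ge0; exists 0; last exact: lin_equiv_refl.
  by move=> p; rewrite coeff0.
case E : (rank _) le0 => [n|//] _.
have /(rank_geP v)/(rank_ge_deg v) : n%:Z <= rank (0 : divisor Gamma) by rewrite E.
by rewrite deg0; lia.
Qed.

End Rank.

(** * Counting values of an affine permutation *)

Section Cardinality.
Variables (T : finType) (U : Type) (f : T -> U) (A : set U).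
Hypothesis f_inj : injective f.

Lemma card_range_finType : range f #= `I_#|T|.
Proof.
have /inj_card_eq h : {in [set: 'I_#|T|] &, injective (f \o enum_val)}.
  by move=> x y _ _ /f_inj/enum_val_inj.
apply: card_eq_trans (card_esym card_II); apply: card_eq_trans h.
rewrite (_ : _ @` _ = range f) ?card_eqxx //.
apply/seteqP; split=> y [x _ <-]; first by exists (enum_val x).
by exists (enum_rank x) => //=; rewrite enum_rankK.
Qed.

Lemma has_card_finType z : A = range f -> has_card A z -> z = #|T|.
Proof.
move=> -> [n -> rn]; congr Posz; apply/card_eq_II.
exact: card_eq_trans (card_esym rn) card_range_finType.
Qed.

Lemma leq_card_finType n : (forall x, A (f x)) -> A #<= `I_n -> (#|T| <= n)%N.
Proof.
move=> fA An; rewrite -card_le_II.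
have le1 : `I_#|T| #<= range f by move: card_range_finType; rewrite card_eq_le => /andP[].
apply: card_le_trans (card_le_trans le1 _) An.
by apply: subset_card_le => _ [x _ <-].
Qed.

End Cardinality.

Definition pos_part (x : int) : nat := absz (Num.max 0 x).

Lemma pos_partE x : (pos_part x)%:Z = Num.max 0 x.
Proof. by rewrite /pos_part; lia. Qed.

Lemma ltn_pos_part (j : nat) (x : int) : (j < pos_part x)%N = (j%:Z < x).
Proof. by rewrite /pos_part; lia. Qed.

Section AffinePermutation.
Variables (k : nat) (tau : int -> int).
Hypothesis tauP : forall n : int, tau (n + k%:Z) = tau n + k%:Z.

Lemma affine_shift (n j : int) : tau (n + j * k%:Z) = tau n + j * k%:Z.
Proof.
elim: j n => [|j IH|j IH] n; first by rewrite !mul0r !addr0.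
  rewrite (_ : n + _ = n + j%:Z * k%:Z + k%:Z) ?tauP ?IH; lia.
have := tauP (n + - j.+1%:Z * k%:Z).
rewrite (_ : _ + _ + _ = n + - j%:Z * k%:Z) ?IH; last by lia.
by move: (tau _) (tau _) => x y; lia.
Qed.

Hypothesis k_gt0 : (0 < k)%N.

Lemma residue_inj (i i' : 'I_k) (a a' : int) :
  i%:Z + a * k%:Z = i'%:Z + a' * k%:Z -> i = i' /\ a = a'.
Proof.
move=> E.
have res (u : 'I_k) (b : int) : ((u%:Z + b * k%:Z) %% k%:Z)%Z = u%:Z.
  by rewrite addrC modzMDl modz_small //= ltz_nat ltn_ord.
have ii : i = i' by apply/val_inj/eqP; rewrite -eqz_nat -(res i a) E res.
split=> //; move: E; rewrite ii => /addrI/mulIf; apply.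
by rewrite eqz_nat -lt0n.
Qed.

Lemma residue_ex (n : int) : exists (i : 'I_k) (a : int), n = i%:Z + a * k%:Z.
Proof.
have k0 : k%:Z != 0 by rewrite eqz_nat -lt0n.
case E : (n %% k%:Z)%Z (modz_ge0 n k0) (ltz_pmod n (k_gt0 : 0 < k%:Z)) => [r|//] _ rk.
by exists (Ordinal (rk : (r < k)%N)), (n %/ k%:Z)%Z; rewrite {1}(divz_eq n k%:Z) E addrC.
Qed.

(** The floor of - tau(i) / k.  Up to order, these are the parts of the splitting
    type. *)
Definition residue_level (i : 'I_k) : int := ((- tau i%:Z) %/ k%:Z)%Z.

(** Dividing tau(i) + j k <= m k by k. *)
Lemma residue_levelP (i : 'I_k) (j m : int) :
  (tau (i%:Z + j * k%:Z) <= m * k%:Z) = (j <= residue_level i + m).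
Proof.
by rewrite affine_shift -lerBlDr lez_divRL // mulrBl; apply/idP/idP; lia.
Qed.

Lemma card_sum_ord (N : 'I_k -> int) : 
  #|{: {i : 'I_k & 'I_(pos_part (N i))}}|%:Z = \sum_i Num.max 0 (N i).
Proof.
rewrite card_tagged sumnE big_map big_enum /= -natz natr_sum.
by apply: eq_bigr => i _; rewrite card_ord natz pos_partE.
Qed.

Lemma card_low_values (m z : int) :
  has_card [set n | 0 <= n /\ tau n <= m * k%:Z] z ->
  z = \sum_i Num.max 0 (residue_level i + m + 1).
Proof.
rewrite -card_sum_ord.
pose f (p : {i : 'I_k & 'I_(pos_part (residue_level i + m + 1))}) : int :=
  (tag p)%:Z + (tagged p)%:Z * k%:Z.
apply: (has_card_finType (f := f)).
  move=> [i j] [i' j'] /residue_inj /= [ii].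
  by case: i' / ii j' => j' [] /val_inj ->.
apply/seteqP; split=> [n [n0 nm]|_ [[i j] _ <-]].
  have [i [a En]] := residue_ex n; move: n0 nm; rewrite {}En residue_levelP => n0 am.
  have a0 : 0 <= a by have := ltn_ord i; nia.
  case: a a0 am n0 => // a _ am n0.
  have lta : (a < pos_part (residue_level i + m + 1))%N by rewrite ltn_pos_part; lia.
  by exists (existT (fun i : 'I_k => 'I_(pos_part (residue_level i + m + 1))) i (Ordinal lta)).
by rewrite /f /= residue_levelP; have := ltn_ord j; rewrite ltn_pos_part => jm; split; nia.
Qed.

Lemma card_high_values (m z : int) :
  has_card [set n | n < 0 /\ m * k%:Z < tau n] z ->
  z = \sum_i Num.max 0 (- (residue_level i + m + 1)).
Proof.
rewrite -card_sum_ord.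
pose f (p : {i : 'I_k & 'I_(pos_part (- (residue_level i + m + 1)))}) : int :=
  (tag p)%:Z + (- (tagged p)%:Z - 1) * k%:Z.
apply: (has_card_finType (f := f)).
  move=> [i j] [i' j'] /residue_inj /= [ii].
  by case: i' / ii j' => j' /addIr/oppr_inj[] /val_inj ->.
apply/seteqP; split=> [n [n0 nm]|_ [[i j] _ <-]].
  have [i [a En]] := residue_ex n; move: n0 nm.
  rewrite {}En [m * _ < _]ltNge residue_levelP -ltNge => n0 am.
  have a0 : a < 0 by nia.
  have lta : (absz (- a - 1) < pos_part (- (residue_level i + m + 1)))%N.
    by rewrite ltn_pos_part; lia.
  exists (existT (fun i : 'I_k => 'I_(pos_part (- (residue_level i + m + 1)))) i (Ordinal lta)) => //.
  by rewrite /f /=; congr (_ + _ * _); lia.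
rewrite /f /= [in X in _ /\ X]ltNge residue_levelP -ltNge.
by have := ltn_ord j; rewrite ltn_pos_part => jm; have := ltn_ord i; split; nia.
Qed.

End AffinePermutation.

(** * Riemann-Roch from rank levels *)

Section RiemannRoch.
Variables (R : realType) (Gamma : graph R) (v : graph_point Gamma) (k : nat).
Implicit Types D E : divisor Gamma.

(** All that the two counting formulas of a transmission permutation say about
    the multiples of [k v], in terms of one integer for each residue modulo k. *)
Definition rank_levels D (nu : 'I_k -> int) := forall m : int,
  rank (D + (m * k%:Z) *: pt v) = \sum_i Num.max 0 (nu i + m + 1) - 1
  /\ rank (canonical_div Gamma - (D + (m * k%:Z) *: pt v))
       = \sum_i Num.max 0 (- (nu i + m + 1)) - 1.

Definition chi D : int := rank D - rank (canonical_div Gamma - D).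

(** This is the identity max(0, x) - max(0, - x) = x, summed over residues. *)
Lemma chi_multiple D nu m : rank_levels D nu ->
  chi (D + (m * k%:Z) *: pt v) = \sum_i (nu i + 1) + m * k%:Z.
Proof.
move=> /(_ m)[rD rK]; rewrite /chi rD rK opprB addrA subrK -sumrB.
transitivity (\sum_i (nu i + 1 + m)); first by apply: eq_bigr => i _; lia.
by rewrite big_split /= sumr_const card_ord pmulrn -mulrzz.
Qed.

Lemma chi_levels D nu : rank_levels D nu -> chi D = \sum_i (nu i + 1).
Proof. by move=> /(chi_multiple 0); rewrite mul0r scale0r !addr0. Qed.

Hypothesis has_levels : forall D, exists nu, rank_levels D nu.

Lemma chi_shift D m : chi (D + (m * k%:Z) *: pt v) = chi D + m * k%:Z.
Proof.
by have [nu lev] := has_levels D; rewrite (chi_multiple _ lev) (chi_levels lev).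
Qed.

(** For large m all the negative parts vanish, hence so does r(K - D - m k v) + 1. *)
Lemma rank_asymptotic D : exists M : int, forall m, M <= m ->
  rank (D + (m * k%:Z) *: pt v) = chi D + m * k%:Z - 1.
Proof.
have [nu lev] := has_levels D; exists (\sum_i `|nu i|) => m Mm.
have [_ rK] := lev m; rewrite -chi_shift /chi rK big1 ?add0r ?opprK ?addrK //.
move=> i _; have : `|nu i| <= \sum_i `|nu i|; last by lia.
by rewrite (bigD1 i) //= lerDl sumr_ge0.
Qed.

Lemma chi_lin_equiv D D' : lin_equiv D D' -> chi D = chi D'.
Proof.
move=> DD'; rewrite /chi (rank_lin_equiv v DD'); congr (_ - _).
by apply: (rank_lin_equiv v); apply: lin_equivB DD'; apply: lin_equiv_refl.
Qed.

(** The corresponding bound for the rank, read off at D + m k v for large m, where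
    rank and chi differ by a constant. *)
Lemma chi_addE D E : effective E -> chi (D + E) <= chi D + deg E.
Proof.
move=> effE; have [M MD] := rank_asymptotic D; have [N ND] := rank_asymptotic (D + E).
have := rank_addE v (D + (Num.max M N * k%:Z) *: pt v) effE.
rewrite addrAC MD ?ND ?le_max ?lexx ?orbT //; lia.
Qed.

Hypothesis k_gt0 : (0 < k)%N.

(** For large m, D' + m k v is equivalent to D plus an effective divisor, and
    deg - chi is unchanged by m k v and cannot decrease under effective
    additions. *)
Lemma chi_deg_le D D' : deg D - chi D <= deg D' - chi D'.
Proof.
have [M MX] := rank_asymptotic (D' - D).
(* At this m the asymptotic rank of D' - D + m k v is nonnegative, as k >= 1. *)
pose m := `|M| + `|chi (D' - D)| + 1.
have mM : M <= m by rewrite /m; lia.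
have /(rank_geP v)/rank_ge0[F effF XF] : 0%:Z <= rank (D' - D + (m * k%:Z) *: pt v).
  by rewrite MX // /m; nia.
have := chi_addE D effF; have := lin_equiv_deg XF.
have := lin_equivD2r D XF; rewrite addrAC subrK => /chi_lin_equiv.
by rewrite chi_shift [F + D]addrC => <-; rewrite degD degB degZ deg_pt; lia.
Qed.

(** Apply [chi_deg_le] to D and K - D in both directions: duality makes
    deg - chi half the degree of K. *)
Lemma chi_deg D : chi D = deg D + 1 - (genus Gamma)%:Z.
Proof.
have dual : chi (canonical_div Gamma - D) = - chi D.
  by rewrite /chi subKr opprB.
have := chi_deg_le D (canonical_div Gamma - D).
have := chi_deg_le (canonical_div Gamma - D) D.
by rewrite dual degB deg_canonical; lia.
Qed.

End RiemannRoch.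

Lemma transmission_levels (R : realType) (Gamma : graph R)
    (v w : graph_point Gamma) (k : nat) (D : divisor Gamma) (tau : int -> int) :
  (0 < k)%N -> is_transmission v w D tau -> affine_perm k tau ->
  rank_levels v D (@residue_level k tau).
Proof.
move=> k0 [_ low high] [_ per] m; split.
  have := low (m * k%:Z) 0; rewrite /twist scale0r subr0.
  by move=> /(card_low_values per k0) <-; rewrite addrK.
have := high (m * k%:Z) 0; rewrite scale0r addr0.
by move=> /(card_high_values per k0) <-; rewrite opprD addrA addrK.
Qed.

(** * Inversions and sizes of splitting types *)

Section Inversions.
Variables (k : nat) (tau : int -> int).
Hypotheses (k_gt0 : (0 < k)%N) (tauP : forall n : int, tau (n + k%:Z) = tau n + k%:Z).
Local Notation nu := (@residue_level k tau).

(** For 1 <= l <= nu_j - nu_i - 1, the pair (i, j + l k) is an inversion: l >= 1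
    gives i < j + l k, and tau(i) - tau(j) > (nu_j - nu_i - 1) k >= l k.
    Only one representative of a k-equivalence class has first entry between 0
    and k - 1, so these inversions lie in different classes. *)
Lemma sum_levels_inversions (n : nat) : inv_le k tau n ->
  \sum_i \sum_j Num.max 0 (nu j - nu i - 1) <= n%:Z.
Proof.
(* The index l ranges over 1, 2, .. and is stored as its predecessor. *)
pose T : finType := {p : 'I_k * 'I_k & 'I_(pos_part (nu p.2 - nu p.1 - 1))}.
pose rep (x : T) : int * int :=
  ((tag x).1%:Z, (tag x).2%:Z + (tagged x).+1%:Z * k%:Z).
pose f x := [set q | inversions tau q /\ k_equiv k (rep x) q].
have rep_inv x : inversions tau (rep x).
  case: x => [[i j] l]; rewrite /inversions /rep /=; split.
    by have := ltn_ord i; nia.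
  rewrite (affine_shift tauP) /=.
  have := ltn_ord l; rewrite ltn_pos_part /= /residue_level => lN.
  have k0 : k%:Z != 0 by rewrite eqz_nat -lt0n.
  have kp : 0 < k%:Z by [].
  have := ltz_pmod (- tau j%:Z) kp; have := modz_ge0 (- tau i%:Z) k0.
  have := divz_eq (- tau i%:Z) k%:Z; have := divz_eq (- tau j%:Z) k%:Z.
  nia.
have f_inj : injective f.
  move=> x y fxy; have : f x (rep y).
    by rewrite fxy; split=> //; exists 0; rewrite mul0r !addr0; case: (rep y).
  case: x y {fxy} => [[i j] l] [[i' j'] l'] [_ [b]]; rewrite /rep /= => -[E1 E2].
  have [ii b0] : i' = i /\ 0 = b by apply: (residue_inj k_gt0); rewrite mul0r addr0.
  subst b i'; rewrite mul0r addr0 in E2.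
  have [jj ll] := residue_inj k_gt0 E2; subst j'.
  by congr existT; apply/val_inj; case: ll.
move=> inv_n.
have leT : (#|T| <= n)%N by apply: (leq_card_finType f_inj _ inv_n) => x; exists (rep x).
apply: (@le_trans _ _ #|T|%:Z); last by rewrite lez_nat.
rewrite card_tagged sumnE big_map big_enum /= -natz natr_sum pair_bigA /=.
rewrite le_eqVlt; apply/orP; left; apply/eqP.
by apply: eq_bigr => p _; rewrite card_ord natz pos_partE.
Qed.

End Inversions.

Section SortedLevels.
Variables (k : nat) (nu : 'I_k -> int).

Definition sorted_levels : k.-tuple int := sort_tuple <=%R [tuple nu i | i < k].

Lemma sum_sorted_levels (F : int -> int) :
  \sum_(i < k) F (tnth sorted_levels i) = \sum_i F (nu i).
Proof.
rewrite -(big_tuple _ _ sorted_levels xpredT F) (perm_big (codom nu)) /=.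
  by rewrite big_map big_enum.
by rewrite perm_sort.
Qed.

Lemma sorted_levelsP : sorted <=%R sorted_levels.
Proof. exact: sort_le_sorted. Qed.

(** In a sorted tuple the pairs with i >= j contribute 0, which makes the size a
    symmetric function of the parts. *)
Lemma split_size_levels :
  split_size sorted_levels = \sum_i \sum_j Num.max 0 (nu j - nu i - 1).
Proof.
rewrite -(sum_sorted_levels (fun x => \sum_j Num.max 0 (nu j - x - 1))).
apply: eq_bigr => i _.
rewrite -(sum_sorted_levels (fun y => Num.max 0 (y - tnth sorted_levels i - 1))).
rewrite big_mkcond; apply: eq_bigr => j _; case: ltnP => // ji.
have : tnth sorted_levels j <= tnth sorted_levels i; last by lia.
rewrite !(tnth_nth 0); apply: (sorted_leq_nth le_trans le_refl 0 sorted_levelsP) => //.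
  by rewrite inE size_tuple.
by rewrite inE size_tuple.
Qed.

End SortedLevels.

(** Translation by k maps the set counted by r(D) + 1 onto the set counted by
    r(D + k v - k w) + 1. *)
Lemma rank_twist_period (R : realType) (Gamma : graph R)
    (v w : graph_point Gamma) (k : nat) (D : divisor Gamma) (tau : int -> int) :
  is_transmission v w D tau -> affine_perm k tau ->
  rank (twist v w D k%:Z k%:Z) = rank D.
Proof.
move=> [_ low _] [_ per].
have [n E1 cn] := low 0 0; have [n' E2 cn'] := low k%:Z k%:Z.
suff nn : n = n' by move: E1 E2; rewrite -nn /twist !scale0r addr0 subr0; lia.
apply/card_eq_II; apply: card_eq_trans (card_esym cn) _; apply: card_eq_trans cn'.
have inj : {in [set n : int | 0 <= n /\ tau n <= 0] &, injective (+%R^~ k%:Z)}.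
  by move=> x y _ _ /addIr.
move: (card_esym (inj_card_eq inj)).
rewrite (_ : _ @` _ = [set n | k%:Z <= n /\ tau n <= k%:Z]) //.
apply/seteqP; split=> y /=.
  by move=> [x [x0 tx] <-]; rewrite per; split; lia.
move=> [ky ty]; exists (y - k%:Z); rewrite ?subrK //.
by have := per (y - k%:Z); rewrite subrK; split; lia.
Qed.

(** * Hurwitz-Brill-Noether generality *)

Theorem theoremC (R : realType) (Gamma : graph R) (v w : graph_point Gamma) (k : nat)
    (hk : (2 <= k)%N) (hgen : general_transmission v w k) :
  [/\ lin_equiv (k%:Z *: pt v) (k%:Z *: pt w),
      1 <= rank (k%:Z *: pt v)
    & forall D : divisor Gamma, exists mu : k.-tuple int,
        [/\ sorted <=%R mu,
            split_size mu <= (genus Gamma)%:Z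
          & splitting_locus mu (k%:Z *: pt v) (div_class D)]].
Proof.
have k0 : (0 < k)%N by exact: ltnW.
have levels D : exists nu : 'I_k -> int, rank_levels v D nu.
  have [_ [tau [tauD affine _]]] := hgen D.
  by exists (@residue_level k tau); apply: transmission_levels tauD affine.
split.
- have [_ [tau [tau0 affine _]]] := hgen 0.
  have : 0%:Z <= rank (twist v w 0 k%:Z k%:Z).
    by rewrite (rank_twist_period tau0 affine) (rank0 v).
  rewrite /twist add0r => /(rank_geP v)/rank_ge0[F effF vwF].
  have /(effective_deg0 effF) F0 : deg F = 0.
    by rewrite -(lin_equiv_deg vwF) degB !degZ !deg_pt subrr.
  by have := lin_equivD2r (k%:Z *: pt w) vwF; rewrite F0 subrK add0r.
- have [nu lev] := levels 0.
  have [r0 _] := lev 0; have [r1 _] := lev 1.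
  move: r0 r1; rewrite mul0r mul1r scale0r !add0r (rank0 v) => r0 ->.
  (* The counts for m = 0 add up to r(0) + 1 = 1, so some part is nonnegative;
     its count strictly increases at m = 1. *)
  have [i nui] : exists i, 0 <= nu i.
    apply/existsP; apply: contraT; rewrite negb_exists => /forallP neg.
    by move: r0; rewrite big1 // => i _; have := neg i; lia.
  have : \sum_j Num.max 0 (nu j + 0 + 1) + 1 <= \sum_j Num.max 0 (nu j + 1 + 1).
    rewrite (bigD1 i) //= [leRHS](bigD1 i) //= addrAC lerD //; first by lia.
    by apply: ler_sum => j _; lia.
  by lia.
- move=> D; have [_ [tau [tauD affine invD]]] := hgen D.
  have lev := transmission_levels k0 tauD affine.
  exists (sorted_levels (@residue_level k tau)); split.
  + exact: sorted_levelsP.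
  + rewrite split_size_levels; apply: sum_levels_inversions invD => //.
    by case: affine.
  split.
    exists D => //; rewrite /= /split_deg (sum_sorted_levels _ (fun x => x + 1)).
    by rewrite -(chi_levels lev) (chi_deg levels k0); lia.
  exists D => // m; have [rD _] := lev m.
  by rewrite scalerA rD /split_x (sum_sorted_levels _ (fun x => Num.max 0 (x + m + 1))).
Qed.
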